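(* Let $f:[0,\infty)\to[0,\infty)$ be $2$-radical convex and let $a,b>0$ with $a\ne b$. Then $$f\left(\frac{a+b}{2}\right)\le \frac{1}{b-a}\int_a^b\left\{f\left(\frac{x+\frac{a+b}{2}}{2}\right)+f\left(\frac{\left|x-\frac{a+b}{2}\right|}{2}\right)\right\}dx\le \frac{1}{b-a}\int_a^b f(x)\,dx.$$
   Context: Let $p\ge 1$. A continuous function $f:[0,\infty)\to[0,\infty)$ with $f(0)=0$ is called $p$-radical convex if the function $x\mapsto f\left(x^{1/p}\right)$ is convex on $[0,\infty)$. In particular $f$ is $2$-radical convex if $x\mapsto f(\sqrt{x})$ is convex on $[0,\infty)$. For $a>b$, $\int_a^b$ denotes $-\int_b^a$. *)

(* Defs.v *)
From Stdlib Require Import Reals Lra.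
From Coquelicot Require Import Coquelicot.
Local Open Scope R_scope.

(** Functions on [[0,oo)] are total functions [R -> R] of which only the values
    on [half_line] are ever constrained or used. *)
Definition half_line (x : R) : Prop := 0 <= x.

Definition convex_on (D : R -> Prop) (g : R -> R) : Prop :=
  forall x y t, D x -> D y -> 0 <= t <= 1 ->
    g (t * x + (1 - t) * y) <= t * g x + (1 - t) * g y.

(** [x^(1/p)] for [x >= 0].  [Rpower 0 y] is [1] in the standard library, so the
    value at [0] has to be set separately. *)
Definition proot (p x : R) : R :=
  if Req_dec_T x 0 then 0 else Rpower x (1 / p).

Record radical_convex (p : R) (f : R -> R) : Prop := {
  radical_convex_exponent : 1 <= p;
  radical_convex_nonneg : forall x, half_line x -> half_line (f x);
  radical_convex_continuous : continuous_on half_line f;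
  radical_convex_at_0 : f 0 = 0;
  radical_convex_convex : convex_on half_line (fun x => f (proot p x))
}.

Lemma proot_2 (x : R) : half_line x -> proot 2 x = sqrt x.
Proof.
unfold half_line, proot; intros Hx.
destruct (Req_dec_T x 0) as [-> | Hx0]; [now rewrite sqrt_0 |].
replace (1 / 2) with (/ 2) by lra.
apply Rpower_sqrt; lra.
Qed.

Lemma radical_convex_2_sqrt (f : R -> R) :
  radical_convex 2 f -> convex_on half_line (fun x => f (sqrt x)).
Proof.
intros Hf x y t Hx Hy Ht.
assert (H := radical_convex_convex _ _ Hf x y t Hx Hy Ht); simpl in H.
rewrite !proot_2 in H; trivial.
unfold half_line in *.
apply Rplus_le_le_0_compat; apply Rmult_le_pos; lra.
Qed.

(* Main.v *)
Require Import Defs.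
From Stdlib Require Import Reals Lra.
From Coquelicot Require Import Coquelicot.
Open Scope R_scope.

(** With [g u = f (sqrt u)] convex, nonnegative and [g 0 = 0], [g] is
    nondecreasing and superadditive on [[0,oo)].  Hence [f] is midpoint convex,
    and the identity [((x+m)/2)^2 + ((x-m)/2)^2 = (x^2 + m^2)/2] yields
    [f ((x+m)/2) + f (|x-m|/2) <= (f x + f m)/2] for [m = (a+b)/2].  Integrating
    this and using [f m <= avg f] gives the upper bound; the lower bound follows
    by averaging the integrand over the reflection [x -> a+b-x]. *)

Section ConvexVanishingAt0.

Variable g : R -> R.
Hypothesis g_convex : convex_on half_line g.
Hypothesis g_0 : g 0 = 0.

Lemma convex_on_scal (t y : R) :
  half_line y -> 0 <= t <= 1 -> g (t * y) <= t * g y.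
Proof.
intros Hy Ht.
assert (H0 : half_line 0) by apply Rle_refl.
assert (H := g_convex y 0 t Hy H0 Ht).
rewrite g_0, !Rmult_0_r, !Rplus_0_r in H; exact H.
Qed.

(** Each of [x] and [y] is a fraction of [x + y], so convexity against the point 0 gives
    [g z <= z / (x + y) * g (x + y)] for both, and the two weights sum to 1. The case [x + y = 0] is
    split off because of the division. *)
Lemma convex_on_superadditive (x y : R) :
  half_line x -> half_line y -> g x + g y <= g (x + y).
Proof.
unfold half_line; intros Hx Hy.
destruct (Req_dec (x + y) 0) as [H | H].
  replace x with 0 by lra; replace y with 0 by lra.
  rewrite Rplus_0_r, g_0; lra.
assert (Hs : 0 < x + y) by lra.
assert (Hfrac : forall z, 0 <= z <= x + y -> g z <= z / (x + y) * g (x + y)).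
{ intros z Hz.
  replace (g z) with (g (z / (x + y) * (x + y))) by (f_equal; field; lra).
  apply convex_on_scal; [unfold half_line; lra | split].
    apply Rdiv_le_0_compat; lra.
  apply Rle_div_l; lra. }
replace (g (x + y))
  with (x / (x + y) * g (x + y) + y / (x + y) * g (x + y)) by (field; lra).
apply Rplus_le_compat; apply Hfrac; lra.
Qed.

(** By superadditivity the increment [g y - g x] is at least [g (y - x)], which is nonnegative. *)
Lemma convex_on_nondecreasing (x y : R) :
  (forall z, half_line z -> half_line (g z)) ->
  half_line x -> x <= y -> g x <= g y.
Proof.
unfold half_line; intros Hg Hx Hxy.
assert (H := convex_on_superadditive x (y - x)).
unfold half_line in H.
assert (H' := Hg (y - x)).
replace (x + (y - x)) with y in H by ring.
specialize (H Hx); lra.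
Qed.

End ConvexVanishingAt0.

(** Composing with [Rabs] replaces [f] by its even extension. As [Rabs] only takes values in
    [half_line], relative continuity there, including at 0, becomes continuity on the whole line,
    which the integrability criterion below needs. *)
Lemma continuous_on_half_line_comp_Rabs (f : R -> R) (x : R) :
  continuous_on half_line f -> continuous (fun y => f (Rabs y)) x.
Proof.
intros Hf.
apply (filterlim_comp _ _ _ Rabs f (locally x)
         (within half_line (locally (Rabs x))) (locally (f (Rabs x)))).
- intros P HP.
  assert (H := continuous_Rabs x _ HP).
  unfold filtermap in *; revert H; apply filter_imp.
  intros y Hy; apply Hy; apply Rabs_pos.
- apply Hf; apply Rabs_pos.
Qed.

Lemma ex_RInt_comp_half_line (f phi : R -> R) (a b : R) :
  a <= b -> continuous_on half_line f ->
  (forall x, continuous phi x) -> (forall x, a <= x <= b -> half_line (phi x)) ->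
  ex_RInt (fun x => f (phi x)) a b.
Proof.
intros Hab Hf Hphi Hpos.
apply ex_RInt_ext with (fun x => f (Rabs (phi x))).
- rewrite Rmin_left, Rmax_right by trivial; intros x Hx.
  rewrite Rabs_pos_eq; trivial; apply Hpos; lra.
- apply (@ex_RInt_continuous R_CompleteNormedModule); intros x _.
  apply (continuous_comp phi (fun y => f (Rabs y))); trivial.
  now apply continuous_on_half_line_comp_Rabs.
Qed.

Lemma is_RInt_reflect (phi : R -> R) (a b l : R) :
  is_RInt phi a b l -> is_RInt (fun x => phi (a + b - x)) a b l.
Proof.
intros H.
(* The substitution has slope -1: it exchanges the endpoints, and the resulting sign is cancelled by
   the factor -1 of the change of variable. *)
assert (H1 : is_RInt phi (-1 * a + (a + b)) (-1 * b + (a + b)) (- l)).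
{ replace (-1 * a + (a + b)) with b by ring.
  replace (-1 * b + (a + b)) with a by ring.
  exact (is_RInt_swap _ _ _ _ H). }
assert (H2 := is_RInt_opp _ _ _ _ (is_RInt_comp_lin _ _ _ _ _ _ H1)).
replace l with (opp (- l)) by exact (Ropp_involutive l).
revert H2; apply is_RInt_ext; intros x _.
replace (-1 * x + (a + b)) with (a + b - x) by ring.
change (- (-1 * phi (a + b - x)) = phi (a + b - x)); ring.
Qed.

(** Adding the integral to its reflected copy doubles it, so a bound on symmetric pairs of points
    suffices. This serves both for the averaged integrand and for [f] itself. *)
Lemma RInt_ge_of_reflect (phi : R -> R) (a b c : R) :
  a <= b -> ex_RInt phi a b ->
  (forall x, a < x < b -> 2 * c <= phi x + phi (a + b - x)) ->
  (b - a) * c <= RInt phi a b.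
Proof.
intros Hab Hex Hc.
assert (H := RInt_correct _ _ _ Hex).
assert (H2 := is_RInt_plus _ _ _ _ _ _ H (is_RInt_reflect _ _ _ _ H)).
assert (Hle := is_RInt_le _ _ _ _ _ _ Hab (is_RInt_const a b (2 * c)) H2 Hc).
change ((b - a) * (2 * c) <= RInt phi a b + RInt phi a b) in Hle; lra.
Qed.

Section RadicalConvex2.

Variable f : R -> R.
Hypothesis hf : radical_convex 2 f.

Let g (u : R) : R := f (sqrt u).

Let g_convex : convex_on half_line g := radical_convex_2_sqrt f hf.

Let g_0 : g 0 = 0.
Proof. unfold g; rewrite sqrt_0; apply (radical_convex_at_0 _ _ hf). Qed.

Let g_sqr (x : R) : half_line x -> g (x * x) = f x.
Proof. intros Hx; unfold g; now rewrite sqrt_square. Qed.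

(** This is midpoint convexity of [g] at [x * x] and [y * y]. The next two lemmas compare their left
    sides with [f] at the quadratic mean. *)
Lemma radical_convex_2_sqr_mean (x y : R) :
  half_line x -> half_line y ->
  f (sqrt ((x * x + y * y) / 2)) <= (f x + f y) / 2.
Proof.
intros Hx Hy.
assert (H := g_convex (x * x) (y * y) (/ 2) (Rle_0_sqr x) (Rle_0_sqr y)
               ltac:(lra)).
rewrite !g_sqr in H by trivial.
replace ((x * x + y * y) / 2)
  with (/ 2 * (x * x) + (1 - / 2) * (y * y)) by field.
unfold g in H; lra.
Qed.

(** The arithmetic mean is at most the quadratic mean, and [g] is nondecreasing. *)
Lemma radical_convex_2_midpoint (x y : R) :
  half_line x -> half_line y -> 2 * f ((x + y) / 2) <= f x + f y.
Proof.
intros Hx Hy.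
assert (Hm := radical_convex_2_sqr_mean x y Hx Hy).
assert (H : g ((x + y) / 2 * ((x + y) / 2)) <= g ((x * x + y * y) / 2)).
{ apply convex_on_nondecreasing; trivial.
  - intros z _; apply (radical_convex_nonneg _ _ hf); apply sqrt_pos.
  - apply Rle_0_sqr.
  - assert (Hs := Rle_0_sqr (x - y)); unfold Rsqr in Hs; lra. }
rewrite g_sqr in H by (unfold half_line in *; lra).
unfold g in H; lra.
Qed.

(** The squares of the two arguments add up to [(x * x + y * y) / 2], so superadditivity of [g]
    bounds the sum by [f] at the quadratic mean. *)
Lemma radical_convex_2_half_sum_diff (x y : R) :
  half_line x -> half_line y ->
  f ((x + y) / 2) + f (Rabs (x - y) / 2) <= (f x + f y) / 2.
Proof.
intros Hx Hy.
apply Rle_trans with (2 := radical_convex_2_sqr_mean x y Hx Hy).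
assert (Hd : half_line (Rabs (x - y) / 2)).
{ assert (H := Rabs_pos (x - y)); unfold half_line; lra. }
assert (H := convex_on_superadditive g g_convex g_0 _ _
               (Rle_0_sqr ((x + y) / 2)) (Rle_0_sqr (Rabs (x - y) / 2))).
unfold Rsqr in H.
rewrite !g_sqr in H by (trivial; unfold half_line in *; lra).
apply Rle_trans with (1 := H); right; unfold g; do 2 f_equal.
assert (Ha : Rabs (x - y) * Rabs (x - y) = (x - y) * (x - y))
  by exact (eq_sym (Rsqr_abs (x - y))).
lra.
Qed.

Lemma ex_RInt_radical_convex (a b : R) : 0 < a -> a < b -> ex_RInt f a b.
Proof.
intros Ha Hab.
apply (ex_RInt_comp_half_line f (fun x => x)).
- lra.
- apply (radical_convex_continuous _ _ hf).
- intros x; apply continuous_id.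
- unfold half_line; intros; lra.
Qed.

Lemma ex_RInt_radical_convex_half_sum_diff (a b m : R) :
  0 < a -> a < b -> half_line m ->
  ex_RInt (fun x => f ((x + m) / 2) + f (Rabs (x - m) / 2)) a b.
Proof.
intros Ha Hab Hm.
assert (Hfc := radical_convex_continuous _ _ hf).
apply (@ex_RInt_plus R_NormedModule).
- apply (ex_RInt_comp_half_line f (fun x => (x + m) / 2)); trivial; [lra | |].
    intros x; apply (@ex_derive_continuous R_AbsRing R_NormedModule).
    auto_derive; trivial.
  unfold half_line in *; intros; lra.
- apply (ex_RInt_comp_half_line f (fun x => Rabs (x - m) / 2)); trivial.
  + lra.
  + intros x.
    apply (continuous_comp (fun x => x - m) (fun y => Rabs y / 2)).
      apply (@ex_derive_continuous R_AbsRing R_NormedModule).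
      auto_derive; trivial.
    apply (continuous_comp Rabs (fun y => y / 2)).
      apply continuous_Rabs.
    apply (@ex_derive_continuous R_AbsRing R_NormedModule).
    auto_derive; trivial.
  + intros x _; assert (H := Rabs_pos (x - m)); unfold half_line; lra.
Qed.

Lemma radical_convex_2_RInt_bounds (a b : R) : 0 < a -> a < b ->
  (b - a) * f ((a + b) / 2)
    <= RInt (fun x => f ((x + (a + b) / 2) / 2)
                      + f (Rabs (x - (a + b) / 2) / 2)) a b
    <= RInt f a b.
Proof.
intros Ha Hab; set (m := (a + b) / 2).
assert (Hm : half_line m) by (unfold half_line, m; lra).
assert (Habs : forall x, half_line (Rabs (x - m) / 2)).
{ intros x; assert (H := Rabs_pos (x - m)); unfold half_line; lra. }
assert (Hf := ex_RInt_radical_convex a b Ha Hab).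
assert (Hsum := ex_RInt_radical_convex_half_sum_diff a b m Ha Hab Hm).
split.
(* The points [(x + m) / 2] and [(a + b - x + m) / 2] have midpoint [m]; the terms with [Rabs] are
   nonnegative and are dropped. *)
- apply RInt_ge_of_reflect; trivial; [lra |]; intros x Hx.
  assert (H1 := radical_convex_nonneg _ _ hf _ (Habs x)).
  assert (H2 := radical_convex_nonneg _ _ hf _ (Habs (a + b - x))).
  assert (H3 := radical_convex_2_midpoint ((x + m) / 2) ((a + b - x + m) / 2)).
  replace (((x + m) / 2 + (a + b - x + m) / 2) / 2) with m in H3
    by (unfold m; field).
  unfold half_line in *.
  assert (2 * f m <= f ((x + m) / 2) + f ((a + b - x + m) / 2))
    by (apply H3; lra).
  lra.
(* The left Hermite-Hadamard inequality for [f]: it lets half of [(b - a) * f m] be absorbed into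
   half of the integral of [f] after the pointwise bound is integrated. *)
- assert (Hmid : (b - a) * f m <= RInt f a b).
  { apply RInt_ge_of_reflect; trivial; [lra |]; intros x Hx.
    replace m with ((x + (a + b - x)) / 2) by (unfold m; field).
    apply radical_convex_2_midpoint; unfold half_line; lra. }
  assert (Hmean : is_RInt (fun x => / 2 * (f x + f m)) a b
                    (/ 2 * (RInt f a b + (b - a) * f m))).
  { apply (is_RInt_scal (V := R_NormedModule)).
    apply (is_RInt_plus (V := R_NormedModule)).
      exact (RInt_correct _ _ _ Hf).
    exact (is_RInt_const a b (f m)). }
  assert (Hle := is_RInt_le _ _ _ _ _ _ (Rlt_le _ _ Hab)
                   (RInt_correct _ _ _ Hsum) Hmean).
  enough (RInt (fun x => f ((x + m) / 2) + f (Rabs (x - m) / 2)) a b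
          <= / 2 * (RInt f a b + (b - a) * f m)) by lra.
  apply Hle; intros x Hx.
  assert (H := radical_convex_2_half_sum_diff x m).
  unfold half_line in *.
  specialize (H ltac:(lra) Hm); lra.
Qed.

Lemma radical_convex_2_mean_bounds (a b : R) : 0 < a -> a < b ->
  f ((a + b) / 2)
    <= 1 / (b - a) *
       RInt (fun x => f ((x + (a + b) / 2) / 2)
                      + f (Rabs (x - (a + b) / 2) / 2)) a b
    <= 1 / (b - a) * RInt f a b.
Proof.
intros Ha Hab.
destruct (radical_convex_2_RInt_bounds a b Ha Hab) as [H1 H2].
assert (Hinv : 0 <= 1 / (b - a)) by (apply Rdiv_le_0_compat; lra).
split; [| now apply Rmult_le_compat_l].
replace (f ((a + b) / 2)) with (1 / (b - a) * ((b - a) * f ((a + b) / 2)))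
  by (field; lra).
now apply Rmult_le_compat_l.
Qed.

End RadicalConvex2.

(** The prefactor and the integral both change sign, so the mean value does not depend on the order
    of the endpoints and [b < a] reduces to the ordered case. *)
Lemma mean_RInt_swap (phi : R -> R) (a b : R) :
  a <> b -> ex_RInt phi b a ->
  1 / (b - a) * RInt phi a b = 1 / (a - b) * RInt phi b a.
Proof.
intros Hab Hex.
replace (RInt phi a b) with (- RInt phi b a) by exact (opp_RInt_swap _ _ _ Hex).
field; lra.
Qed.

Theorem theorem2p4 (f : R -> R) (a b : R)
    (hf : radical_convex 2 f) (ha : 0 < a) (hb : 0 < b) (hab : a <> b) :
  f ((a + b) / 2)
    <= 1 / (b - a) *
       RInt (fun x => f ((x + (a + b) / 2) / 2)
                      + f (Rabs (x - (a + b) / 2) / 2)) a b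
  /\
  1 / (b - a) *
    RInt (fun x => f ((x + (a + b) / 2) / 2)
                   + f (Rabs (x - (a + b) / 2) / 2)) a b
    <= 1 / (b - a) * RInt f a b.
Proof.
destruct (Rdichotomy a b hab) as [Hlt | Hgt].
  exact (radical_convex_2_mean_bounds f hf a b ha Hlt).
assert (Hm : half_line ((a + b) / 2)) by (unfold half_line; lra).
rewrite !(mean_RInt_swap _ a b); trivial.
(* The midpoint, also inside the integrand, must be written as [(b + a) / 2] to match the bounds
   with the endpoints exchanged. *)
- rewrite (Rplus_comm a b).
  exact (radical_convex_2_mean_bounds f hf b a hb Hgt).
- now apply ex_RInt_radical_convex.
- now apply ex_RInt_radical_convex_half_sum_diff.
Qed.
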